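(* If $G$ is a finitely generated group, then $G$ acts properly on a finite product of locally finite trees if and only if $G$ acts properly on a finite product of bounded valence trees.
   Context: All trees are simplicial trees, regarded as metric spaces with each edge of length 1. A tree is locally finite if every vertex has finite valence, and has bounded valence if there is a uniform finite upper bound on the valences of its vertices. A finite product $P=T_1\times\dots\times T_n$ of trees carries its natural cube complex structure (and the $\ell_2$ product metric). An action of a group $G$ on $P$ is a homomorphism from $G$ to the group $\mathrm{Aut}(P)$ of automorphisms of the cube complex $P$; it may permute factors, may invert edges, and need not be faithful. The action is proper if the stabiliser in $G$ of every vertex of $P$ is a finite group. *)

(* Defs.v *)
From mathcomp Require Import all_boot.
From mathcomp Require Import boolp classical_sets functions cardinality.

Set Implicit Arguments.
Unset Strict Implicit.
Unset Printing Implicit Defensive.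

Local Open Scope classical_set_scope.

Definition finitely_generated (G : groupType) : Prop :=
  exists s : seq G, forall H : {pred G},
    group_closed H -> {subset s <= H} -> forall g, g \in H.

(* Acyclicity: in a loopless graph, [ucycle] also accepts the empty sequence
   and every pair [:: x; y] of adjacent vertices; genuine circuits are those
   of length at least 3. *)
Record tree : Type := Tree {
  vertex :> eqType;
  adj : rel vertex;
  adj_sym : symmetric adj;
  adj_irr : irreflexive adj;
  tree_nonempty : inhabited vertex;
  tree_connected : forall x y, exists2 p, path adj x p & last x p = y;
  tree_acyclic : forall c, ucycle adj c -> size c <= 2
}.

Definition locally_finite (T : tree) : Prop :=
  forall x : T, finite_set [set y | adj x y].

Definition bounded_valence (T : tree) : Prop :=
  exists k : nat, forall x : T, ([set y | adj x y] #<= `I_k)%card.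

Section Product.
Variables (n : nat) (T : 'I_n -> tree).

Definition prod_vertex : Type := forall i, T i.

(* A cell of a tree, or a cube of a product, is represented by its set of
   vertices, which determines it. *)
Definition is_cell (U : tree) (A : set U) : Prop :=
  (exists x, A = [set x]) \/ (exists x y, adj x y /\ A = [set x; y]).

Definition is_cube (C : set prod_vertex) : Prop :=
  exists c : forall i, set (T i),
    (forall i, is_cell (c i)) /\ C = [set x | forall i, c i (x i)].

Definition cube_automorphism (f : prod_vertex -> prod_vertex) : Prop :=
  bijective f /\ forall C, is_cube (f @` C) <-> is_cube C.

Definition is_action (G : groupType) (rho : G -> prod_vertex -> prod_vertex) :
    Prop :=
  (forall g, cube_automorphism (rho g)) /\
  (forall g h, rho (g * h)%g = rho g \o rho h).

Definition is_proper (G : groupType) (rho : G -> prod_vertex -> prod_vertex) :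
    Prop :=
  forall v, finite_set [set g | rho g v = v].

End Product.

Definition acts_properly_on_product (G : groupType) (Q : tree -> Prop) : Prop :=
  exists (n : nat) (T : 'I_n -> tree),
    (forall i, Q (T i)) /\
    exists rho : G -> prod_vertex T -> prod_vertex T,
      is_action rho /\ is_proper rho.

(* Main.v *)
(** Finite generation yields a finite set [W] of vertices of the product [P]
    whose orbit [Y = G W] spans a connected subgraph of the 1-skeleton. Each
    projection of [Y] to a factor is then a subtree, and its valence at [y_i] is
    at most the valence of [P] at [y], which takes finitely many values on [Y]
    because [G] acts on the 1-skeleton. The product of these subtrees is the
    convex hull of [Y], i.e. the closure of [Y] under adding common neighbours
    of two distinct points, so it is [G]-invariant. In particular one does not
    need to know that automorphisms of [P] permute the factors. *)

Require Import Defs.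
From mathcomp Require Import all_boot.
From mathcomp Require Import boolp classical_sets functions cardinality.

Set Implicit Arguments.
Unset Strict Implicit.
Unset Printing Implicit Defensive.

Local Open Scope classical_set_scope.

(** * Walks inside a set of vertices *)

Section Connectivity.
Variables (V : Type) (e : V -> V -> Prop).

Inductive walk (A : set V) : V -> V -> Prop :=
| walk0 x : A x -> walk A x x
| walkS x y z : A x -> e x y -> walk A y z -> walk A x z.

Lemma walk_start A x y : walk A x y -> A x.
Proof. by case. Qed.

Lemma walk_sub (A B : set V) x y : A `<=` B -> walk A x y -> walk B x y.
Proof.
move=> AB; elim=> {x y} [x Ax|x y z Ax exy _ IH]; first exact/walk0/AB.
exact: (walkS (AB _ Ax) exy IH).
Qed.

Lemma walk_trans A x y z : walk A x y -> walk A y z -> walk A x z.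
Proof.
move=> Axy; elim: Axy z => {x y} // x y z Ax exy _ IH t /IH.
exact: walkS.
Qed.

Lemma walk_sym A x y : (forall x y, e x y -> e y x) ->
  walk A x y -> walk A y x.
Proof.
move=> esym; elim=> {x y} [x|x y z Ax exy Ayz IH]; first exact: walk0.
apply: (walk_trans IH).
exact: (walkS (walk_start Ayz) (esym _ _ exy) (walk0 Ax)).
Qed.

(** [W] collects the vertices of the walk; each of them is reached by an initial segment that stays
    in [W]. *)
Lemma walk_finite A x y : walk A x y -> exists W : set V,
  [/\ finite_set W, W y & forall w, W w -> walk W x w].
Proof.
elim=> {x y} [x _|x y z _ exy _ [W [finW Wz Wy]]].
  by exists [set x]; split=> // w ->; exact: walk0.
exists (x |` W); split; first by rewrite finite_setU.
  by right.
move=> w [->|Ww]; first by apply: walk0; left.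
apply: (walkS _ exy); first by left.
by apply: (walk_sub _ (Wy _ Ww)) => t; right.
Qed.

End Connectivity.

(** Edges may collapse, so that this applies to projections onto a factor as well as to
    automorphisms. *)
Lemma walk_map (V V' : Type) (e : V -> V -> Prop) (e' : V' -> V' -> Prop)
    (f : V -> V') (A : set V) x y :
  (forall a b, e a b -> f a = f b \/ e' (f a) (f b)) ->
  walk e A x y -> walk e' (f @` A) (f x) (f y).
Proof.
move=> fe; elim=> {x y} [x Ax|x y z Ax exy _ IH]; first by apply: walk0; exists x.
by have [->//|e'xy] := fe _ _ exy; apply: (walkS _ e'xy IH); exists x.
Qed.

(** * Connected subsets of a tree as trees *)

Definition tree_walk (T : tree) (A : set T) : T -> T -> Prop :=
  walk (fun x y : T => adj x y) A.

Definition subtree_connected (T : tree) (Q : set T) : Prop :=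
  forall x y, Q x -> Q y -> tree_walk Q x y.

Section Trees.
Variable T : tree.
Implicit Types Q : set T.

Lemma tree_walk_setT (x y : T) : tree_walk setT x y.
Proof.
have [p] := tree_connected x y.
elim: p x => [|z p IH] x /=; first by move=> _ <-; exact: walk0.
by move=> /andP[xz zp] lp; apply: walkS xz (IH _ zp lp).
Qed.

Lemma tree_walk_path Q (x y : T) : tree_walk Q x y ->
  exists p, [/\ path (@adj T) x p, last x p = y & forall z, z \in p -> Q z].
Proof.
elim=> {x y} [x Qx|x y z Qx xy Qyz [p [yp lp pQ]]]; first by exists nil.
exists (y :: p); split; rewrite //= ?xy // => t; rewrite inE.
by case/orP => [/eqP->|/pQ//]; exact: walk_start Qyz.
Qed.

(** A simple path from [a] to [b] inside [Q] that missed [c] would close up through [c] to a circuit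
    of length at least 3. *)
Lemma subtree_middle Q (a b c : T) : subtree_connected Q -> Q a -> Q b ->
  a <> b -> adj a c -> adj b c -> Q c.
Proof.
move=> Qconn Qa Qb ab ac bc; apply: contrapT => Qc.
have [p [ap lp pQ]] := tree_walk_path (Qconn _ _ Qa Qb).
case: (shortenP ap) lp => q aq uq qp lq.
suff : size [:: c, a & q] <= 2.
  by case: q lq {aq uq qp} => [/ab[]|].
apply: (@tree_acyclic T); apply/andP; split.
  by rewrite /= rcons_path adj_sym ac aq /= lq.
rewrite cons_uniq uq andbT; apply/negP; rewrite inE => /orP[/eqP ca|/qp/pQ//].
by rewrite ca in Qc.
Qed.

Section Subtree.
Variable Q : set T.
Hypotheses (Q_ne : exists x, Q x) (Q_conn : subtree_connected Q).

(** Using the boolean [[< Q x >]] makes [val] injective and lets the subtype inherit its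
    [eqType]. *)
Let V := {x : T | `[< Q x >]}.
Let sub_adj : rel V := fun x y => adj (val x) (val y).

Fact sub_adj_sym : symmetric sub_adj.
Proof. by move=> x y; exact: adj_sym. Qed.

Fact sub_adj_irr : irreflexive sub_adj.
Proof. by move=> x; exact: adj_irr. Qed.

Fact sub_nonempty : inhabited V.
Proof. by have [x /asboolP Qx] := Q_ne; exists; exists x. Qed.

Fact sub_connected (x y : V) : exists2 p, path sub_adj x p & last x p = y.
Proof.
have [p [xp lp pQ]] :=
  tree_walk_path (Q_conn (asboolW (valP x)) (asboolW (valP y))).
elim: p x xp lp pQ => [|z p IH] x /=.
  by move=> _ /val_inj xy _; exists nil.
move=> /andP[xz zp] lp pQ.
have Qz : `[< Q z >] by apply/asboolP/pQ; rewrite mem_head.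
have [|q zq lq] := IH (exist _ z Qz) zp lp.
  by move=> t tp; apply: pQ; rewrite inE tp orbT.
by exists (exist _ z Qz :: q) => //=; rewrite zq andbT.
Qed.

Fact sub_acyclic (c : seq V) : ucycle sub_adj c -> size c <= 2.
Proof.
move=> /andP[cc uc]; rewrite -(size_map val); apply: (@tree_acyclic T).
apply/andP; split; last by rewrite map_inj_uniq //; exact: val_inj.
case: c cc {uc} => //= x c; rewrite -map_rcons.
by rewrite path_map.
Qed.

Definition subtree : tree :=
  Tree sub_adj_sym sub_adj_irr sub_nonempty sub_connected sub_acyclic.

End Subtree.
End Trees.

(** * The 1-skeleton of a product of trees, and hulls in it *)

Section Products.
Variables (n : nat) (T : 'I_n -> tree).
Notation P := (prod_vertex T).
Implicit Types (a b c v w z : P).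

Definition prod_adj a b : Prop :=
  exists2 i, adj (a i) (b i) & forall j, j != i -> a j = b j.

Lemma prod_adj_sym a b : prod_adj a b -> prod_adj b a.
Proof. by case=> i ab E; exists i; rewrite 1?adj_sym// => j /E. Qed.

Lemma prod_adj_neq a b : prod_adj a b -> a <> b.
Proof. by case=> i + _ E; rewrite E adj_irr. Qed.

Lemma prod_adj_coord i a b : prod_adj a b -> a i = b i \/ adj (a i) (b i).
Proof.
case=> j ab E; have [->|/E] := eqVneq i j; first by right.
by left.
Qed.

Lemma prod_adj_dfwith i a (x y : T i) : adj x y ->
  prod_adj (dfwith a x) (dfwith a y).
Proof.
move=> xy; exists i; first by rewrite !dfwith_in.
by move=> j ji; rewrite !dfwith_out// eq_sym.
Qed.

Lemma dfwith_id i a : dfwith a (a i) = a.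
Proof. by apply: functional_extensionality_dep => j; case: dfwithP. Qed.

Lemma cell_adj (U : tree) (A : set U) x y :
  is_cell A -> A x -> A y -> x <> y -> adj x y.
Proof.
case=> [[z ->]|[z [t [zt ->]]]]; first by move=> -> ->.
by move=> [->|->] [->|->] // _; rewrite adj_sym.
Qed.

Lemma prod_adj_cube a b : prod_adj a b -> is_cube [set a; b].
Proof.
case=> i ab E; exists (fun j => [set a j; b j]); split=> [j|].
  have [->|/E ->] := eqVneq j i; first by right; exists (a i), (b i).
  by left; exists (b j); rewrite setUid.
apply/seteqP; split=> x /=; first by move=> [->|->] j; [left|right].
move=> abx; have eqx c : c i = x i -> (forall j, j != i -> a j = c j) -> x = c.
  move=> ci cE; apply: functional_extensionality_dep => j.
  have [->//|ji] := eqVneq j i; rewrite -cE//.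
  by case: (abx j) => // ->; rewrite E.
by case: (abx i) => xi; [left|right]; apply: eqx.
Qed.

Lemma cube_prod_adj a b : a <> b -> is_cube [set a; b] -> prod_adj a b.
Proof.
move=> ab [c [cell_c abE]].
have ca i : c i (a i).
  by have : [set a; b] a by [left]; rewrite abE; exact.
have cb i : c i (b i).
  by have : [set a; b] b by [right]; rewrite abE; exact.
have [i abi] : exists i, a i <> b i.
  by apply/existsNP => E; apply: ab; exact: functional_extensionality_dep.
exists i => [|j ji]; first exact: cell_adj (cell_c i) _ _ _.
(* A cube contains every vertex whose coordinates are taken from [a] and [b]. This mixed vertex
   differs from [a] at [i], so it is [b], which forces [a] and [b] to agree at [j]. *)
have : [set a; b] (dfwith a (b i)).
  by rewrite abE /= => k; case: dfwithP.
case=> [/(congr1 (fun z => z i))|/(congr1 (fun z => z j))].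
  by rewrite dfwith_in => /esym.
by rewrite dfwith_out// eq_sym.
Qed.

(** Edges are exactly the cubes with two vertices, so a bijection preserving cubes preserves
    adjacency. *)
Lemma automorphism_adj (f : P -> P) a b :
  cube_automorphism f -> prod_adj a b -> prod_adj (f a) (f b).
Proof.
move=> [/bij_inj f_inj fcube] ab.
apply: cube_prod_adj; first by move=> /f_inj; exact: prod_adj_neq.
by rewrite -image_set1 -[[set f b]]image_set1 -image_setU fcube; exact: prod_adj_cube.
Qed.

(** Coordinates are moved to those of [b] one at a time, each along a walk in its own tree. *)
Lemma prod_walk_setT a b : walk prod_adj setT a b.
Proof.
have step i c (y : T i) : walk prod_adj setT c (dfwith c y).
  rewrite -{1}(dfwith_id i c); apply: (walk_sub (A := dfwith (i:=i) c @` setT)) => //.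
  apply: walk_map (tree_walk_setT _ _) => x z xz.
  by right; exact: prod_adj_dfwith.
suff /(_ n (leqnn n)) [c ac cb] : forall k, k <= n ->
    exists2 c, walk prod_adj setT a c & forall i : 'I_n, i < k -> c i = b i.
  suff <- : c = b by [].
  by apply: functional_extensionality_dep => i; exact: cb.
elim=> [|k IH] kn; first by exists a => //; exact: walk0.
have [c ac cb] := IH (ltnW kn); pose i := Ordinal kn.
exists (dfwith c (b i)); first exact: walk_trans ac (step _ _ _).
move=> j; rewrite ltnS leq_eqVlt => /orP[jk|jk].
  by rewrite (ord_inj (eqP jk : nat_of_ord j = i)) dfwith_in.
by rewrite dfwith_out ?cb// -val_eqE neq_ltn /= jk orbT.
Qed.

Lemma prod_neighbours_finite a : (forall i, locally_finite (T i)) ->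
  finite_set [set b | prod_adj a b].
Proof.
move=> Tfin.
apply: (@sub_finite_set _ _
  (\bigcup_(i in [set: 'I_n]) (dfwith (i:=i) a @` [set y : T i | adj (a i) y]))).
  move=> b [i ab E]; exists i => //; exists (b i) => //.
  apply: functional_extensionality_dep => j.
  by case: dfwithP => // k ik; rewrite E// eq_sym.
by apply: bigcup_finite => [|i _]; [exact: finite_finset|exact/finite_image/Tfin].
Qed.

(* The convex hull of a connected set [Y] in the median graph [P]: it is
   generated by local moves alone, which makes its equivariance evident. *)
Inductive hull (Y : set P) : P -> Prop :=
| hull_base v : Y v -> hull Y v
| hull_square a b c : hull Y a -> hull Y b -> a <> b ->
    prod_adj a c -> prod_adj b c -> hull Y c.

Lemma hull_image (f : P -> P) (Y : set P) v : cube_automorphism f ->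
  (forall v, Y v -> Y (f v)) -> hull Y v -> hull Y (f v).
Proof.
move=> fauto fY; elim=> {v} [v /fY|a b c _ Yfa _ Yfb ab ac bc].
  exact: hull_base.
have f_inj := bij_inj fauto.1.
apply: (hull_square Yfa Yfb) => [/f_inj//||]; exact: automorphism_adj.
Qed.

(* Pushes the [j]-th coordinates of the points of the walk along the squares
   spanned by direction [j] and the successive steps of the walk. *)
Lemma hull_slide (Y : set P) j z y : walk prod_adj (hull Y) z y ->
  tree_walk [set t | hull Y (dfwith z t)] (z j) (y j).
Proof.
elim=> {z y} [z Yz|z z' y Yz zz' Yz'y IH].
  by apply: walk0; rewrite /= dfwith_id.
have [i zi E] := zz'; have [ij|ij] := eqVneq j i.
  rewrite -{}ij in zi E.
  (* A step in direction [j] itself does not change the line in direction [j], so the walk given by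
     induction is merely prolonged. *)
  have zz'E t : dfwith (i:=j) z t = dfwith z' t.
    apply: functional_extensionality_dep => k.
    by case: dfwithP => [|k' ?]; rewrite ?dfwith_in// dfwith_out// E// eq_sym.
  apply: walkS zi _; first by rewrite /= dfwith_id.
  by apply: walk_sub IH => t /=; rewrite zz'E.
rewrite (E j ij).
have : hull Y (dfwith z (z' j)) by rewrite -(E j ij) dfwith_id.
elim: IH => {y Yz'y} [s _|s t u Ys st Yt IH] zs; first exact: walk0.
have zz'a r : prod_adj (dfwith (i:=j) z' r) (dfwith z r).
  exists i; first by rewrite !dfwith_out// adj_sym.
  move=> k; case: dfwithP => [|k' jk' k'i]; first by rewrite dfwith_in.
  by rewrite dfwith_out// E.
(* The square has corners [dfwith z s], [dfwith z' s], [dfwith z' t], [dfwith z t]; the last is a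
   common neighbour of the first and the third, which lie in the hull and differ at [i]. *)
apply: (walkS zs st); apply: IH.
apply: (hull_square zs (walk_start Yt) _ _ (zz'a t)); last exact: prod_adj_dfwith.
move=> /(congr1 (fun z => z i)); rewrite !dfwith_out// => zz'i.
by rewrite zz'i adj_irr in zi.
Qed.

Definition prod_connected (Y : set P) : Prop :=
  forall x y, Y x -> Y y -> walk prod_adj Y x y.

(** Each point added to the hull is adjacent to an earlier one, so every hull point is joined to [Y]
    within the hull. *)
Lemma hull_connected (Y : set P) : prod_connected Y -> prod_connected (hull Y).
Proof.
move=> Yconn.
have toY x : hull Y x -> exists2 y, Y y & walk prod_adj (hull Y) x y.
  elim=> {x} [v Yv|a b c Ya [y Yy ay] Yb _ ab ac bc].
    by exists v => //; apply/walk0/hull_base.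
  exists y => //; apply: walkS (prod_adj_sym ac) ay.
  exact: hull_square ab ac bc.
move=> x x' /toY[y Yy xy] /toY[y' Yy' x'y'].
apply: walk_trans xy _; apply: walk_trans (walk_sym prod_adj_sym x'y').
by apply: walk_sub (Yconn _ _ Yy Yy') => v; exact: hull_base.
Qed.

Definition proj_set (Y : set P) i : set (T i) := (fun v => v i) @` Y.
Arguments proj_set Y i _ : clear implicits.

Lemma proj_connected (Y : set P) i :
  prod_connected Y -> subtree_connected (proj_set Y i).
Proof.
move=> Yconn _ _ [v Yv <-] [w Yw <-]; apply: walk_map (Yconn _ _ Yv Yw).
exact: prod_adj_coord.
Qed.

(** The product of the projections absorbs common neighbours by [subtree_middle]. Conversely, any
    point of it is reached from [v0] by correcting one coordinate at a time, sliding within the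
    hull. *)
Lemma hull_product (Y : set P) : Y !=set0 -> prod_connected Y ->
  hull Y = [set v | forall i, proj_set Y i (v i)].
Proof.
move=> [v0 Yv0] Yconn; apply/seteqP; split=> v /=.
  elim=> {v} [v Yv i|a b c _ Ya _ Yb ab [i ac aE] [j bc bE] k]; first by exists v.
  (* Only the case where both edges have direction [k] remains; then [a] and [b] differ at [k]
     alone, and [c k] is a common neighbour of [a k] and [b k]. *)
  have [ki|/aE <-//] := eqVneq k i; have [kj|/bE <-//] := eqVneq k j.
  rewrite -{i}ki in ac aE *; rewrite -{j}kj in bc bE *.
  apply: (subtree_middle (proj_connected Yconn) (Ya k) (Yb k)) ac bc => abk.
  apply: ab; apply: functional_extensionality_dep => i.
  by have [->//|ik] := eqVneq i k; rewrite aE ?bE.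
move=> Yv; suff /(_ n (leqnn n)) [c Yc cv] : forall k, k <= n ->
    exists2 c, hull Y c & forall i : 'I_n, i < k -> c i = v i.
  suff <- : c = v by [].
  by apply: functional_extensionality_dep => i; exact: cv.
elim=> [|k IH] kn; first by exists v0 => //; exact: hull_base.
have [c Yc cv] := IH (ltnW kn); pose i := Ordinal kn.
exists (dfwith c (v i)).
  have [y Yy <-] := Yv i.
  (* Sliding [c] towards a point [y] of [Y] with [y i = v i] ends at [dfwith c (v i)]. *)
  have cy := hull_slide i (hull_connected Yconn Yc (hull_base Yy)).
  by apply: walk_start (walk_sym _ cy) => x z; rewrite adj_sym.
move=> j; rewrite ltnS leq_eqVlt => /orP[jk|jk].
  by rewrite (ord_inj (eqP jk : nat_of_ord j = i)) dfwith_in.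
by rewrite dfwith_out ?cv// -val_eqE neq_ltn /= jk orbT.
Qed.

End Products.
Arguments proj_set {n T} Y i _.

(** * Group laws for actions *)

Section Actions.
Variables (n : nat) (T : 'I_n -> tree) (G : groupType).
Variable rho : G -> prod_vertex T -> prod_vertex T.
Hypothesis rho_act : is_action rho.

(** [rho 1] is idempotent and injective, hence the identity. *)
Lemma action1 x : rho 1%g x = x.
Proof.
have rho1_inj := bij_inj (rho_act.1 1%g).1.
apply: rho1_inj; have /(congr1 (fun f => f x)) := rho_act.2 1%g 1%g.
by rewrite mulg1.
Qed.

Lemma actionM g h x : rho (g * h)%g x = rho g (rho h x).
Proof. by rewrite rho_act.2. Qed.

Lemma actionK g : cancel (rho g) (rho g^-1%g).
Proof. by move=> x; rewrite -actionM mulVg action1. Qed.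

Lemma actionKV g : cancel (rho g^-1%g) (rho g).
Proof. by move=> x; rewrite -actionM mulgV action1. Qed.

End Actions.

(** * Restricting an action to an invariant product of subtrees *)

Section Restriction.
Variables (n : nat) (T : 'I_n -> tree) (Q : forall i, set (T i)).
Arguments Q i _ : clear implicits.
Hypotheses (Q_ne : forall i, exists x, Q i x).
Hypothesis (Q_conn : forall i, subtree_connected (Q i)).
Notation P := (prod_vertex T).

Definition subtrees i : tree := subtree (Q_ne i) (@Q_conn i).

Definition prod_val (x : prod_vertex subtrees) : P := fun i => val (x i).

Definition prod_sub (x : P) (Qx : forall i, Q i (x i)) : prod_vertex subtrees :=
  fun i => exist _ (x i) (asboolT (Qx i)).

Lemma prod_valP x i : Q i (prod_val x i).
Proof. exact: asboolW (valP (x i)). Qed.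

Lemma prod_val_inj : injective prod_val.
Proof.
move=> x y xy; apply: functional_extensionality_dep => i.
exact/val_inj/(congr1 (fun z => z i) xy).
Qed.

Lemma cell_nonempty (U : tree) (A : set U) : is_cell A -> exists x, A x.
Proof. by case=> [[x ->]|[x [y [_ ->]]]]; exists x => //; left. Qed.

Lemma cell_subtree i (A : set (T i)) : A `<=` Q i ->
  is_cell A -> is_cell ([set x | A (val x)] : set (subtrees i)).
Proof.
move=> AQ; case=> [[x Ax]|[x [y [xy Axy]]]].
  have Qx : Q i x by apply: AQ; rewrite Ax.
  left; exists (exist _ x (asboolT Qx)); apply/seteqP; split=> z /=.
    by rewrite Ax => zx; exact: val_inj.
  by move=> ->; rewrite Ax.
have Qx : Q i x by apply: AQ; rewrite Axy; left.
have Qy : Q i y by apply: AQ; rewrite Axy; right.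
right; exists (exist _ x (asboolT Qx)), (exist _ y (asboolT Qy)); split=> //.
apply/seteqP; split=> z /=; rewrite Axy.
  by move=> [zx|zy]; [left|right]; exact: val_inj.
by move=> [->|->]; [left|right].
Qed.

Lemma cell_val i (A : set (subtrees i)) : is_cell A ->
  is_cell ((fun x : subtrees i => val x) @` A : set (T i)).
Proof.
case=> [[x ->]|[x [y [xy ->]]]]; first by left; exists (val x); rewrite image_set1.
by right; exists (val x), (val y); split=> //; rewrite image_setU !image_set1.
Qed.

(** This lets cube preservation pass from an automorphism of [P] to its restriction. *)
Lemma cube_val (C : set (prod_vertex subtrees)) :
  is_cube (prod_val @` C) <-> is_cube C.
Proof.
split=> [[c [cell_c CE]]|[c [cell_c ->]]].
  have [p cp] : exists p : P, forall i, c i (p i).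
    by exists (fun i => sval (cid (cell_nonempty (cell_c i)))) => i; case: cid.
  (* The point [p] of the cube supplies the other coordinates, so that each [y] in [c i] is a
     coordinate of a point of the image. *)
  have cQ i : c i `<=` Q i.
    move=> y cy; have : (prod_val @` C) (dfwith p y).
      by rewrite CE /= => j; case: dfwithP.
    by case=> x _ /(congr1 (fun z => z i)); rewrite dfwith_in => <-; exact: prod_valP.
  exists (fun i => [set x | c i (val x)]); split=> [i|].
    exact: cell_subtree (@cQ i) (cell_c i).
  apply/seteqP; split=> x /=.
    move=> Cx; suff : (prod_val @` C) (prod_val x) by rewrite CE.
    by exists x.
  move=> cx; have : (prod_val @` C) (prod_val x) by rewrite CE.
  by case=> y Cy /prod_val_inj <-.
exists (fun i => (fun x : subtrees i => val x) @` c i); split=> [i|].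
  exact: cell_val.
apply/seteqP; split=> x /=; first by move=> [y cy <-] i; exists (y i).
move=> cx; exists (fun i => sval (cid2 (cx i))) => [i|]; first by case: cid2.
by apply: functional_extensionality_dep => i; rewrite /prod_val; case: cid2.
Qed.

Section Action.
Variables (G : groupType) (rho : G -> P -> P).
Hypothesis rho_act : is_action rho.
Hypothesis rho_Q : forall g (x : P), (forall i, Q i (x i)) ->
  forall i, Q i (rho g x i).

Definition restrict_action (g : G) (x : prod_vertex subtrees) :
  prod_vertex subtrees := prod_sub (rho_Q g (prod_valP x)).

Lemma restrict_actionE g x :
  prod_val (restrict_action g x) = rho g (prod_val x).
Proof. by []. Qed.

Lemma restrict_is_action : is_action restrict_action.
Proof.
split=> [g|g h]; last first.
  apply/funext => x; apply: prod_val_inj.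
  by rewrite /comp !restrict_actionE (actionM rho_act).
split.
  exists (restrict_action g^-1%g) => x; apply: prod_val_inj.
    by rewrite !restrict_actionE (actionK rho_act).
  by rewrite !restrict_actionE (actionKV rho_act).
move=> C; rewrite -!cube_val.
have -> : prod_val @` (restrict_action g @` C) = rho g @` (prod_val @` C).
  by rewrite !image_comp.
exact: (rho_act.1 g).2.
Qed.

Lemma restrict_is_proper : is_proper rho -> is_proper restrict_action.
Proof.
move=> rho_proper v; apply: sub_finite_set (rho_proper (prod_val v)).
by move=> g /= gv; rewrite -restrict_actionE gv.
Qed.

End Action.
End Restriction.

(** * A connected union of finitely many orbits *)

Section CocompactSubset.
Variables (n : nat) (T : 'I_n -> tree).
Notation P := (prod_vertex T).
Variables (G : groupType) (rho : G -> P -> P).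
Hypothesis rho_act : is_action rho.

Definition orbit_set (W : set P) : set P :=
  [set v | exists g, exists2 w, W w & v = rho g w].

Lemma orbit_set_stable W g v : orbit_set W v -> orbit_set W (rho g v).
Proof.
by move=> [h [w Ww ->]]; exists (g * h)%g, w => //; rewrite (actionM rho_act).
Qed.

Lemma orbit_walk W g x y : walk (@prod_adj _ T) (orbit_set W) x y ->
  walk (@prod_adj _ T) (orbit_set W) (rho g x) (rho g y).
Proof.
move=> xy; apply: (walk_sub (A := rho g @` orbit_set W)).
  by move=> _ [v Wv <-]; exact: orbit_set_stable.
apply: walk_map xy => a b ab; right.
exact: automorphism_adj (rho_act.1 g) ab.
Qed.

(** [W] is a finite union of walks from [v0] to its translates by the generators. The elements [g]
    for which [v0] and [rho g v0] are joined in the orbit of [W] form a subgroup containing the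
    generators. *)
Lemma cocompact_connected : finitely_generated G ->
  exists W : set P, [/\ W !=set0, finite_set W & prod_connected (orbit_set W)].
Proof.
move=> [s gen_s].
have v0 : P by move=> i; exact: inhabited_witness (tree_nonempty (T i)).
have [W [finW Wv0 Ws Wwalk]] : exists W : set P, [/\ finite_set W, W v0,
    forall g, g \in s -> W (rho g v0) &
    forall w, W w -> walk (@prod_adj _ T) W v0 w].
  elim: s {gen_s} => [|g s [W [finW Wv0 Ws Wwalk]]].
    by exists [set v0]; split=> // w ->; exact: walk0.
  have [W' [finW' W'g W'walk]] := walk_finite (prod_walk_setT v0 (rho g v0)).
  exists (W `|` W'); split; first by rewrite finite_setU.
  - by left.
  - by move=> h; rewrite inE => /orP[/eqP ->|/Ws]; [right|left].
  - move=> w [/Wwalk|/W'walk]; apply: walk_sub => t; first by left.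
    by right.
exists W; split=> //; first by exists v0.
have WO : W `<=` orbit_set W.
  by move=> w Ww; exists 1%g, w; rewrite ?(action1 rho_act).
have to_v0 g : walk (@prod_adj _ T) (orbit_set W) v0 (rho g v0).
  pose H : {pred G} := fun g => `[< walk (@prod_adj _ T) (orbit_set W) v0 (rho g v0) >].
  suff /asboolP : g \in H by [].
  apply: gen_s => [|h hs]; last first.
    by apply/asboolP/(walk_sub WO)/Wwalk/Ws.
  split; first by apply/asboolP; rewrite (action1 rho_act); exact/walk0/WO.
  move=> a b /asboolP Ha /asboolP Hb; apply/asboolP; rewrite (actionM rho_act).
  apply: (walk_trans Ha); apply: orbit_walk.
  (* Translated by the inverse of [b] and reversed, the walk from [v0] to [rho b v0] leads from [v0]
     to [rho b^-1 v0]. *)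
  have := orbit_walk b^-1%g Hb; rewrite (actionK rho_act).
  exact/walk_sym/prod_adj_sym.
have to_any v : orbit_set W v -> walk (@prod_adj _ T) (orbit_set W) v0 v.
  move=> [g [w Ww ->]]; apply: walk_trans (to_v0 g) _.
  exact/orbit_walk/(walk_sub WO)/Wwalk.
move=> x y /to_any x0 /to_any; apply: walk_trans.
exact: walk_sym (@prod_adj_sym _ T) x0.
Qed.

(** A neighbour of [v i] lifts to a neighbour of [v = rho g w] in [P], which [rho g^-1] carries into
    the finite set [N]. Counting in [P] rather than in one factor yields a bound independent of [g],
    even if factors are permuted. *)
Lemma orbit_valence W : (forall i, locally_finite (T i)) -> finite_set W ->
  exists k, forall (v : P) i, orbit_set W v ->
    ([set y | adj (v i) y] #<= `I_k)%card.
Proof.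
move=> Tfin finW; pose N := \bigcup_(w in W) [set b | prod_adj w b].
have /finite_set_leP[k Nk] : finite_set N.
  by apply: bigcup_finite => // w _; exact: prod_neighbours_finite.
exists k => v i [g [w Ww ->]]; apply: card_le_trans Nk.
apply: card_le_trans (card_image_le (fun b => rho g b i) N).
apply: subset_card_le => y /= wy.
exists (rho g^-1%g (dfwith (rho g w) y)); last first.
  by rewrite (actionKV rho_act) dfwith_in.
exists w => //=; rewrite -{1}(actionK rho_act g w).
apply: automorphism_adj; first exact: rho_act.1.
by rewrite -{1}(dfwith_id i (rho g w)); exact: prod_adj_dfwith.
Qed.

End CocompactSubset.

(** * Valence bounds and the two implications *)

Lemma bounded_valence_locally_finite (T : tree) :
  bounded_valence T -> locally_finite T.
Proof. by move=> [k Tk] x; apply/finite_set_leP; exists k. Qed.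

Lemma subtree_bounded (T : tree) (Q : set T) Q_ne (Q_conn : subtree_connected Q) k :
  (forall x, Q x -> ([set y | adj x y] #<= `I_k)%card) ->
  bounded_valence (subtree Q_ne Q_conn).
Proof.
move=> Qk; exists k => x; apply: card_le_trans (Qk _ (asboolW (valP x))).
(* [insubd x] fixes the points of [Q] and sends all others to the default [x], so the image of the
   neighbours in [T] contains all neighbours in the subtree. *)
apply: card_le_trans (card_image_le (insubd x) _).
apply: subset_card_le => y /= xy; exists (val y) => //; exact: valKd.
Qed.

Theorem lemma2p7 (G : groupType) (hG : finitely_generated G) :
  acts_properly_on_product G locally_finite <->
  acts_properly_on_product G bounded_valence.
Proof.
split=> [[n [T [Tfin [rho [rho_act rho_proper]]]]]|]; last first.
  move=> [n [T [Tbd rhoP]]]; exists n, T; split=> // i.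
  exact: bounded_valence_locally_finite.
have [W [[w0 Ww0] finW Yconn]] := cocompact_connected rho_act hG.
set Y := orbit_set rho W in Yconn.
have Yw0 : Y w0 by exists 1%g, w0; rewrite ?(action1 rho_act).
have Q_ne i : exists x, proj_set Y i x by exists (w0 i), w0.
have Q_conn i := proj_connected (i := i) Yconn.
have hullE := hull_product (ex_intro _ _ Yw0) Yconn.
have rho_Q g (x : prod_vertex T) : (forall i, proj_set Y i (x i)) ->
    forall i, proj_set Y i (rho g x i).
  (* Invariance is checked on the hull, since [rho g] is not known to respect the factors. *)
  move=> Yx; suff : [set v | forall i, proj_set Y i (v i)] (rho g x) by [].
  rewrite -hullE; apply: (hull_image (rho_act.1 g)); last by rewrite hullE.
  by move=> v; exact: orbit_set_stable.
exists n, (subtrees Q_ne Q_conn); split=> [i|].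
  have [k Yk] := orbit_valence rho_act Tfin finW.
  apply: (@subtree_bounded _ _ _ _ k) => _ [v Yv <-]; exact: Yk.
exists (restrict_action rho_Q); split; first exact: restrict_is_action.
exact: restrict_is_proper.
Qed.
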